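(* Consider an instance of the Ticket to Ride problem and let $(x^*,y^* )$ be an optimal solution to the mixed-integer program $$\max \ \sum_{e\in E} f_e x_e+\sum_{k\in K} d_k\, y_{(t_k,s_k),k}$$ subject to $$\sum_{e\in E} l_e x_e\le \beta,$$ $$y_{(i,j),k}+y_{(j,i),k}\le x_e \quad \text{for all } e=\{i,j\}\in E \text{ and all } k\in K,$$ $$\sum_{j:(j,i)\in\mathcal{A}^k} y_{(j,i),k}-\sum_{j:(i,j)\in\mathcal{A}^k} y_{(i,j),k}=0\quad \text{for all } k\in K \text{ and all } i\in V,$$ $$x\in\{0,1\}^{|E|},\qquad y_{(i,j),k}\in\{0,1\}\quad \text{for all } k\in K \text{ and all } (i,j)\in\mathcal{A}^k.$$ Then $E'=\{e\in E \mid x^*_e=1\}$ is an optimal solution to the Ticket to Ride problem; the set of tickets it satisfies is $K(E')=\{k\in K \mid y^*_{(t_k,s_k),k}=1\}$; and its total points are $$F(E')=\sum_{e\in E} f_e x^*_e+\sum_{k\in K} d_k\, y^*_{(t_k,s_k),k}.$$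
   Context: Ticket to Ride instance. $G=(V,E)$ is a finite connected undirected graph with no self-loops and no parallel edges. The vertices are linearly ordered, and each edge is written $e=\{i,j\}$ with $i<j$. Each edge $e\in E$ has a length $l_e>0$ and a point value $f_e>0$. $K$ is a finite set of tickets; each ticket $k\in K$ is given by a pair of nodes $s_k,t_k\in V$ with $s_k<t_k$ and a point value $d_k>0$. It is assumed that $s_k$ and $t_k$ lie in the same connected component of $G$, and that no ticket coincides with a single edge, i.e. $\{s_k,t_k\}\notin E$ for all $k\in K$. A budget $\beta>0$ is given. Completed tickets and points. For $E'\subseteq E$, $G'=(V',E')$ is the (possibly disconnected) edge-induced subgraph, where $V'\subseteq V$ consists of the vertices incident to at least one edge of $E'$. The set of completed (satisfied) tickets is $K(E')=\{k\in K \mid s_k \text{ and } t_k \text{ are connected in } G'\}$, and the total points of $E'$ are $F(E')=\sum_{e\in E'} f_e+\sum_{k\in K(E')} d_k$. The Ticket to Ride problem is $\max_{E'\subseteq E}\{F(E') \mid \sum_{e\in E'} l_e\le\beta\}$. Arc sets. For each ticket $k$, $\mathcal{A}^k$ consists of, for each edge $e=\{i,j\}\in E$ with $i<j$, the forward arc $(i,j)$ and the backward arc $(j,i)$, together with one dummy arc $(t_k,s_k)$. The dummy arcs do not appear in the constraints $y_{(i,j),k}+y_{(j,i),k}\le x_e$. *)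

(* Defs.v *)
From HB Require Import structures.
From mathcomp Require Import all_boot all_order all_algebra.

Set Implicit Arguments.
Unset Strict Implicit.
Unset Printing Implicit Defensive.

Import Order.TTheory GRing.Theory Num.Theory.
Local Open Scope ring_scope.

Definition optimal (R : realFieldType) (T : Type) (feasible : T -> Prop)
    (objective : T -> R) (z : T) : Prop :=
  feasible z /\ forall z', feasible z' -> objective z' <= objective z.

(* An undirected edge {i, j} with i < j is represented by the pair (i, j), so a
   set of such pairs is a graph without loops and without parallel edges. *)
Definition adj (V : finType) (F : {set V * V}) : rel V :=
  fun i j => ((i, j) \in F) || ((j, i) \in F).

Definition induced_vertices (V : finType) (F : {set V * V}) : {set V} :=
  [set i | [exists j, adj F i j]].

(* Connectedness of i and j in the edge-induced subgraph, hence the membership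
   conditions: connect is reflexive also at vertices incident to no edge of F. *)
Definition connected_in (V : finType) (F : {set V * V}) (i j : V) : bool :=
  [&& i \in induced_vertices F, j \in induced_vertices F & connect (adj F) i j].

(* The values of length and epoint on pairs that are not edges are irrelevant. *)
Record instance (R : realFieldType) (disp : Order.disp_t)
    (V : finOrderType disp) (K : finType) := Instance {
  edges : {set V * V};
  length : V * V -> R;
  epoint : V * V -> R;
  src : K -> V;
  dst : K -> V;
  tpoint : K -> R;
  budget : R;
  edges_lt : forall e, e \in edges -> (e.1 < e.2)%O;
  graph_connected : forall i j, connect (adj edges) i j;
  length_gt0 : forall e, e \in edges -> 0 < length e;
  epoint_gt0 : forall e, e \in edges -> 0 < epoint e;
  src_lt_dst : forall k, (src k < dst k)%O;
  tpoint_gt0 : forall k, 0 < tpoint k;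
  ticket_connected : forall k, connect (adj edges) (src k) (dst k);
  ticket_notin_edges : forall k, (src k, dst k) \notin edges;
  budget_gt0 : 0 < budget
}.

Section TicketToRide.

Variables (R : realFieldType) (disp : Order.disp_t) (V : finOrderType disp).
Variables (K : finType) (I : instance R V K).

Definition completed (F : {set V * V}) : {set K} :=
  [set k | connected_in F (src I k) (dst I k)].

Definition points (F : {set V * V}) : R :=
  \sum_(e in F) epoint I e + \sum_(k in completed F) tpoint I k.

Definition ttr_feasible (F : {set V * V}) : Prop :=
  F \subset edges I /\ \sum_(e in F) length I e <= budget I.

Definition ttr_optimal (F : {set V * V}) : Prop :=
  optimal ttr_feasible points F.

Definition dummy_arc (k : K) : V * V := (dst I k, src I k).

Definition arcs (k : K) : {set V * V} :=
  dummy_arc k |: (edges I :|: [set (e.2, e.1) | e in edges I]).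

(* A candidate z is the pair (x, y), with y k (i, j) for y_{(i,j),k}. Only the
   values of x on edges and of y k on arcs k are constrained or used. *)
Definition mip_vars : Type := ((V * V -> R) * (K -> V * V -> R))%type.

Definition mip_objective (z : mip_vars) : R :=
  \sum_(e in edges I) epoint I e * z.1 e
  + \sum_k tpoint I k * z.2 k (dummy_arc k).

Record mip_feasible (z : mip_vars) : Prop := MipFeasible {
  mip_budget : \sum_(e in edges I) length I e * z.1 e <= budget I;
  mip_capacity : forall i j k, (i, j) \in edges I ->
    z.2 k (i, j) + z.2 k (j, i) <= z.1 (i, j);
  mip_conservation : forall k i,
    \sum_(j | (j, i) \in arcs k) z.2 k (j, i)
    - \sum_(j | (i, j) \in arcs k) z.2 k (i, j) = 0;
  mip_x_binary : forall e, e \in edges I -> z.1 e = 0 \/ z.1 e = 1;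
  mip_y_binary : forall k a, a \in arcs k -> z.2 k a = 0 \/ z.2 k a = 1
}.

Definition mip_optimal (z : mip_vars) : Prop :=
  optimal mip_feasible mip_objective z.

End TicketToRide.

(* Main.v *)
Require Import Defs.
From HB Require Import structures.
From mathcomp Require Import all_boot all_order all_algebra.

Set Implicit Arguments.
Unset Strict Implicit.
Unset Printing Implicit Defensive.

Import Order.TTheory GRing.Theory Num.Theory.
Local Open Scope ring_scope.

(** The program and the combinatorial problem have the same optimal value, and
    each feasible solution of one yields a solution of the other that is at
    least as good.

    From the program to the graph: a dummy arc that carries one unit sends it
    from [dst k] back to [src k].  By conservation the unit must return from
    [src k] to [dst k] through edge arcs, and capacity only lets it use edges
    with [x e = 1]; a cut argument on the set of vertices reachable from
    [src k] makes this precise ([dummy_connected]).  Hence every ticket paid by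
    the objective is completed by [support I x], and the objective is at most
    the points of that set ([mip_objective_le_points]).

    From the graph to the program: if [F] completes the ticket [k], a simple
    path of [F] from [src k] to [dst k], closed up by the dummy arc, is a simple
    cycle, whose indicator is a 0/1 circulation that respects the capacities
    given by [F] ([ticket_circulation]).  So the points of any affordable [F]
    are the objective of some feasible solution ([exists_mip_lift]).

    For an optimal solution, with support [E'], lifting [E'] itself gives
    points of [E'] <= objective <= points of [E'].  Equality holds, which
    transfers optimality; as ticket values are positive, it also leaves no
    ticket that is completed without being paid. *)

(** * Sums of binary variables and strict monotonicity *)

Lemma sum_binary (R : nzRingType) (T : finType) (P : pred T) (f x : T -> R) :
  (forall e, P e -> x e = 0 \/ x e = 1) ->
  \sum_(e | P e) f e * x e = \sum_(e | P e && (x e == 1)) f e.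
Proof.
move=> xP; rewrite big_mkcondr; apply: eq_bigr => e /xP [] ->.
  by rewrite eq_sym oner_eq0 mulr0.
by rewrite eqxx mulr1.
Qed.

Lemma sum_subset_eq (R : realFieldType) (T : finType) (A B : {set T})
    (d : T -> R) :
  (forall k, 0 < d k) -> A \subset B ->
  \sum_(k in B) d k <= \sum_(k in A) d k -> A = B.
Proof.
move=> d0 AB; apply: contraTeq => nAB.
have /properP[_ [k kB kA]] : A \proper B by rewrite properEneq nAB.
rewrite -ltNge [ltRHS](big_setID A) /= (setIidPr AB) ltrDl (big_setD1 k) /=; last first.
  by rewrite inE kA.
by rewrite ltr_wpDr // sumr_ge0 // => i _; exact: ltW.
Qed.

(** * Circulations: cuts and simple cycles *)

(** Summing conservation over [S], the arcs inside [S] contribute equally to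
    both sides and cancel. *)
Lemma circulation_cut (R : zmodType) (V : finType) (w : V -> V -> R)
    (S : {set V}) :
  (forall i, \sum_j w j i = \sum_j w i j) ->
  \sum_(i in S) \sum_(j in ~: S) w j i = \sum_(i in S) \sum_(j in ~: S) w i j.
Proof.
move=> cons.
have split_sum (g : V -> V -> R) : \sum_(i in S) \sum_j g i j =
    \sum_(i in S) \sum_(j in S) g i j + \sum_(i in S) \sum_(j in ~: S) g i j.
  rewrite -big_split; apply: eq_bigr => i _; rewrite (bigID (mem S)) /=.
  by congr (_ + _); apply: eq_bigl => j; rewrite inE.
have := split_sum (fun i j => w j i).
rewrite (eq_bigr (fun i => \sum_j w i j)) ?split_sum => [|i _]; last exact: cons.
by rewrite [in RHS]exchange_big /= => /addrI.
Qed.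

Definition cycle_flow (R : pzRingType) (V : eqType) (c : seq V) (a : V * V) : R :=
  ((a.1 \in c) && (next c a.1 == a.2))%:R.

(** A vertex of a simple cycle has exactly one arc of the cycle coming in, from
    its predecessor, and one going out, to its successor. *)
Lemma cycle_circulation (R : pzRingType) (V : finType) (A : {set V * V})
    (c : seq V) (i : V) :
  uniq c -> cycle (fun i j => (i, j) \in A) c ->
  \sum_(j | (j, i) \in A) cycle_flow R c (j, i) =
  \sum_(j | (i, j) \in A) cycle_flow R c (i, j).
Proof.
move=> Uc Cc; rewrite /cycle_flow /=.
have [ic|nic] := boolP (i \in c); last first.
  rewrite !big1 // => j _; case: andP => // -[jc /eqP ji].
  by rewrite -ji mem_next jc in nic.
have prev_arc : (prev c i, i) \in A := prev_cycle Cc ic.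
have next_arc : (i, next c i) \in A := next_cycle Cc ic.
rewrite (bigD1 (prev c i)) //= mem_prev ic next_prev // eqxx.
rewrite [RHS](bigD1 (next c i)) //= eqxx.
rewrite !big1 // => j /andP[_ nj].
  by rewrite eq_sym (negbTE nj).
by case: andP => // -[_ /eqP ji]; rewrite -ji prev_next ?eqxx in nj.
Qed.

Lemma index_next (V : eqType) (s : V) (p : seq V) (i : V) :
  uniq (s :: p) -> i \in s :: p -> i != last s p ->
  index (next (s :: p) i) (s :: p) = (index i (s :: p)).+1.
Proof.
move=> Up ip il.
have lt_ip : (index i (s :: p) < size p)%N.
  rewrite ltn_neqAle -ltnS -[(size p).+1]/(size (s :: p)) index_mem ip andbT.
  by apply: contraNneq il => E; rewrite (last_nth s) -E nth_index.
rewrite next_nth ip -[nth s p _]/(nth s (s :: p) _.+1).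
by rewrite index_uniq.
Qed.

(** * Connectedness in edge sets *)

Lemma adj_sym (V : finType) (F : {set V * V}) : symmetric (adj F).
Proof. by move=> i j; rewrite /adj orbC. Qed.

(** A nontrivial walk leaves its first vertex and enters its last one by an
    edge, so its ends are incident to edges. *)
Lemma connect_connected_in (V : finType) (F : {set V * V}) (i j : V) :
  i != j -> connect (adj F) i j -> connected_in F i j.
Proof.
have incident a b : a != b -> connect (adj F) a b -> a \in induced_vertices F.
  move=> ab /connectP[[|z p] /= Pp E]; first by rewrite E eqxx in ab.
  by rewrite inE; apply/existsP; exists z; case/andP: Pp.
move=> ij Cij; apply/and3P; split=> //; first exact: incident Cij.
apply: (incident j i); first by rewrite eq_sym.
by rewrite (sym_connect_sym (@adj_sym _ F)).
Qed.

(** * Supports of feasible solutions *)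

Section Instance.

Variables (R : realFieldType) (disp : Order.disp_t) (V : finOrderType disp).
Variables (K : finType) (I : instance R V K).

Implicit Types (F : {set V * V}) (k : K).

Definition support (x : V * V -> R) : {set V * V} := [set e in edges I | x e == 1].

Definition paid (y : K -> V * V -> R) : {set K} := [set k | y k (dummy_arc I k) == 1].

Lemma mem_arcs k i j :
  ((i, j) \in arcs I k) = ((i, j) == dummy_arc I k) || adj (edges I) i j.
Proof.
rewrite !inE /adj; congr (_ || (_ || _)).
apply/imsetP/idP => [[[a b] ab [-> ->]]//|ji]; by exists (j, i).
Qed.

Lemma edge_antisym i j : (i, j) \in edges I -> (j, i) \notin edges I.
Proof.
move=> /(@edges_lt _ _ _ _ I) /= ij; apply/negP => /(@edges_lt _ _ _ _ I) /=.
by rewrite ltNge (ltW ij).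
Qed.

Lemma adj_edge F i j :
  F \subset edges I -> (i, j) \in edges I -> adj F i j -> (i, j) \in F.
Proof.
move=> /subsetP FE ij /orP[//|/FE ji]; by rewrite (negbTE (edge_antisym ij)) in ji.
Qed.

(** Both orientations of an edge avoid the dummy arc: the forward one because
    [src k < dst k], the backward one because no ticket is an edge. *)
Lemma edge_not_dummy k i j :
  (i, j) \in edges I -> (i, j) != dummy_arc I k /\ (j, i) != dummy_arc I k.
Proof.
move=> ij; split; apply: contraTneq ij => -[-> ->].
  apply/negP => /(@edges_lt _ _ _ _ I) /=.
  by rewrite ltNge (ltW (src_lt_dst I k)).
exact: ticket_notin_edges.
Qed.

Lemma support_sub x : support x \subset edges I.
Proof. by apply/subsetP => e; rewrite inE => /andP[]. Qed.

Lemma sum_support (f x : V * V -> R) :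
  (forall e, e \in edges I -> x e = 0 \/ x e = 1) ->
  \sum_(e in edges I) f e * x e = \sum_(e in support x) f e.
Proof. by move=> xP; rewrite sum_binary //; apply: eq_bigl => e; rewrite inE. Qed.

Lemma mip_y_ge0 z k a : mip_feasible I z -> a \in arcs I k -> 0 <= z.2 k a.
Proof. by move=> Hz /(mip_y_binary Hz) [] ->. Qed.

(** An arc other than the dummy arc shares its unit of capacity with the
    opposite arc, whose flow is nonnegative; a positive flow thus forces
    [x e = 1]. *)
Lemma arc_flow_support z k i j :
  mip_feasible I z -> adj (edges I) i j -> z.2 k (i, j) != 0 ->
  adj (support z.1) i j.
Proof.
move=> Hz Aij nz.
have y1 : z.2 k (i, j) = 1.
  have := mip_y_binary Hz (k := k) (a := (i, j)).
  by rewrite mem_arcs Aij orbT => /(_ isT) [] // E; rewrite E eqxx in nz.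
have y0 : 0 <= z.2 k (j, i).
  by apply: mip_y_ge0 => //; rewrite mem_arcs adj_sym Aij orbT.
have one e : e \in edges I -> 1 <= z.1 e -> e \in support z.1.
  move=> eE; rewrite inE eE.
  by case: (mip_x_binary Hz eE) => ->; rewrite ?eqxx // ler10.
case/orP: Aij => ijE; apply/orP; [left|right]; apply: one => //.
  by apply: le_trans (mip_capacity Hz k ijE); rewrite y1 lerDl.
by apply: le_trans (mip_capacity Hz k ijE); rewrite y1 lerDr.
Qed.

(** If [dst k] were not reachable from [src k] within the support, the dummy
    arc would enter the reachable set while no flow could leave it. *)
Lemma dummy_connected z k :
  mip_feasible I z -> z.2 k (dummy_arc I k) = 1 ->
  connect (adj (support z.1)) (src I k) (dst I k).
Proof.
move=> Hz y1; apply/negPn/negP => ndst.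
pose S := [set i | connect (adj (support z.1)) (src I k) i].
pose w i j := if (i, j) \in arcs I k then z.2 k (i, j) else 0.
have w_ge0 i j : 0 <= w i j.
  by rewrite /w; case: ifP => // /(mip_y_ge0 Hz).
have cons i : \sum_j w j i = \sum_j w i j.
  by rewrite -!big_mkcond; apply/eqP; rewrite -subr_eq0; apply/eqP/(mip_conservation Hz).
have out0 : \sum_(i in S) \sum_(j in ~: S) w i j = 0.
  rewrite big1 // => i iS; rewrite big1 // => j; rewrite inE => jS.
  rewrite /w mem_arcs; case: eqP => [[E _]|_] /=.
    by rewrite inE E (negbTE ndst) in iS.
  case: ifP => // Aij; apply/eqP; apply: contraNT jS => nz.
  rewrite !inE in iS *; apply: connect_trans iS (connect1 _).
  exact: arc_flow_support nz.
have := circulation_cut S cons; rewrite out0 => /eqP.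
apply/negP; rewrite gt_eqF //.
rewrite (bigD1 (src I k)) ?inE ?connect0 //= (bigD1 (dst I k)) ?inE //=.
rewrite {1}/w mem_arcs eqxx /= -[(_, _)]/(dummy_arc I k) y1.
by rewrite -addrA ltr_wpDr // addr_ge0 // !sumr_ge0 // => *; rewrite sumr_ge0.
Qed.

Lemma paid_completed z :
  mip_feasible I z -> paid z.2 \subset completed I (support z.1).
Proof.
move=> Hz; apply/subsetP => k; rewrite !inE => /eqP /(dummy_connected Hz).
by apply: connect_connected_in; rewrite lt_eqF ?src_lt_dst.
Qed.

Lemma mip_objectiveE z : mip_feasible I z ->
  mip_objective I z =
    \sum_(e in support z.1) epoint I e + \sum_(k in paid z.2) tpoint I k.
Proof.
move=> Hz; congr (_ + _).
  by rewrite sum_support //; exact: mip_x_binary Hz.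
rewrite sum_binary //.
  by apply: eq_bigl => k; rewrite inE.
by move=> k _; apply: (mip_y_binary Hz); rewrite mem_arcs eqxx.
Qed.

Lemma support_feasible z : mip_feasible I z -> ttr_feasible I (support z.1).
Proof.
move=> Hz; split; first exact: support_sub.
rewrite -sum_support; first exact: mip_budget Hz.
exact: mip_x_binary Hz.
Qed.

Lemma mip_objective_le_points z :
  mip_feasible I z -> mip_objective I z <= points I (support z.1).
Proof.
move=> Hz; rewrite mip_objectiveE // lerD2l.
rewrite [leRHS](big_setID (paid z.2)) /= (setIidPr (paid_completed Hz)) lerDl.
by rewrite sumr_ge0 // => k _; apply/ltW/tpoint_gt0.
Qed.

(** * Lifting edge sets to feasible solutions *)

(** The indicator of the cycle formed by a simple path and the dummy arc.
    Along the path positions increase, so the path never traverses an edge in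
    both directions and capacity 1 suffices. *)
Lemma ticket_circulation F k : F \subset edges I ->
  exists w : V * V -> R,
  [/\ forall i j, (i, j) \in edges I -> w (i, j) + w (j, i) <= ((i, j) \in F)%:R,
      forall i, \sum_(j | (j, i) \in arcs I k) w (j, i) =
                \sum_(j | (i, j) \in arcs I k) w (i, j),
      forall a, w a = 0 \/ w a = 1
    & w (dummy_arc I k) = (k \in completed I F)%:R].
Proof.
move=> FE; have [|nk] := boolP (k \in completed I F); last first.
  exists (fun=> 0); split=> // [i j _|i|a]; last by left.
  - by rewrite addr0 ler0n.
  - by rewrite !big1.
rewrite inE => /and3P[_ _ /connectP[q Pq Eq]].
case/shortenP: Pq Eq => p Pp Up _ Ep.
set c := src I k :: p.
(* The last vertex of the path wraps around to the first: this is the dummy arc. *)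
have next_dst : next c (dst I k) = src I k.
  rewrite /c next_nth Ep mem_last index_last //.
  by rewrite nth_default.
have cyc : cycle (fun i j => ((i, j) == dummy_arc I k) || adj F i j) c.
  rewrite /= rcons_path -Ep eqxx andbT.
  by apply: sub_path Pp => i j ->; rewrite orbT.
have cyc_arcs : cycle (fun i j => (i, j) \in arcs I k) c.
  apply: sub_cycle cyc => i j; rewrite mem_arcs => /orP[->//|Aij].
  by apply/orP; right; case/orP: Aij => /(subsetP FE) H; rewrite /adj H ?orbT.
have used i j : (i, j) != dummy_arc I k -> i \in c -> next c i = j ->
    adj F i j /\ index j c = (index i c).+1.
  move=> nd ic ij; split.
    by have := next_cycle cyc ic; rewrite ij (negbTE nd).
  rewrite -ij index_next // -Ep; apply: contraNneq nd => E.
  by rewrite -ij E next_dst.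
exists (cycle_flow R c); split.
- move=> i j ijE; have [nd nd'] := edge_not_dummy k ijE.
  rewrite /cycle_flow /=.
  case: andP => [[ic /eqP ij]|_]; case: andP => [[jc /eqP ji]|_].
  + have [_ Ej] := used _ _ nd ic ij; have [_ Ei] := used _ _ nd' jc ji.
    by move/eqP: Ei; rewrite Ej ltn_eqF // ltnS leqnSn.
  + have [Aij _] := used _ _ nd ic ij.
    by rewrite (adj_edge FE ijE Aij) addr0.
  + have [Aji _] := used _ _ nd' jc ji.
    by rewrite (adj_edge FE ijE) ?add0r // adj_sym.
  + by rewrite addr0 ler0n.
- by move=> i; exact: cycle_circulation.
- by move=> a; rewrite /cycle_flow; case: (_ && _); [right|left].
- have dst_c : dst I k \in c by rewrite Ep mem_last.
  by rewrite /cycle_flow [_.1]/= [_.2]/= next_dst dst_c eqxx.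
Qed.

Lemma exists_mip_lift F : ttr_feasible I F ->
  exists2 z, mip_feasible I z & mip_objective I z = points I F.
Proof.
case=> FE HF; have [y Hy] := fin_all_exists (fun k => ticket_circulation k FE).
pose x e : R := (e \in F)%:R.
have suppF : support x = F.
  apply/setP => e; rewrite inE /x; case: (boolP (e \in F)) => [/(subsetP FE)->|_].
    by rewrite eqxx.
  by rewrite eq_sym oner_eq0 andbF.
have xP e : e \in edges I -> x e = 0 \/ x e = 1.
  by rewrite /x; case: (e \in F); [right|left].
have Hz : mip_feasible I (x, y).
  split=> //=.
  - by rewrite sum_support // suppF.
  - by move=> i j k ijE; case: (Hy k) => cap _ _ _; exact: cap.
  - by move=> k i; case: (Hy k) => _ -> _ _; rewrite subrr.
  - by move=> k a _; case: (Hy k).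
exists (x, y) => //; rewrite mip_objectiveE //= suppF; congr (_ + _).
apply: eq_bigl => k; rewrite inE; case: (Hy k) => _ _ _ ->.
by case: (k \in _); rewrite ?eqxx // eq_sym oner_eq0.
Qed.

End Instance.

Theorem proposition2 (R : realFieldType) (disp : Order.disp_t)
    (V : finOrderType disp) (K : finType) (I : instance R V K)
    (x : V * V -> R) (y : K -> V * V -> R)
    (hopt : mip_optimal I (x, y)) :
  let E' := [set e in edges I | x e == 1] in
  [/\ ttr_optimal I E',
      completed I E' = [set k | y k (dst I k, src I k) == 1]
    & points I E' = \sum_(e in edges I) epoint I e * x e
                    + \sum_k tpoint I k * y k (dst I k, src I k)].
Proof.
move=> E'; case: hopt => Hz Hmax.
have lift_le F : ttr_feasible I F -> points I F <= mip_objective I (x, y).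
  by move=> /exists_mip_lift[z Hz' <-]; exact: Hmax.
have E'feas : ttr_feasible I E' := support_feasible Hz.
have E'pts : points I E' = mip_objective I (x, y).
  by apply/le_anti; rewrite lift_le //= (mip_objective_le_points Hz).
split=> //.
- by split=> // F HF; rewrite E'pts lift_le.
- apply/esym; apply: (sum_subset_eq (tpoint_gt0 I) (paid_completed Hz)).
  by move: E'pts; rewrite mip_objectiveE // => /addrI ->.
Qed.
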